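(* Let $\mathscr B$ be a doubling and regular ball-basis in a measure space $(X,\mathfrak M,\mu)$ and let $1\le r<\infty$. There is a constant $\alpha\in(1/2,1)$, depending only on the ball-basis $\mathscr B$ and on $r$, such that $\mathrm{BMO}_\alpha(X)=\mathrm{BMO}(X)$. Moreover, there are constants $c,C>0$ depending only on $\mathscr B$ and $r$ such that for every $f\in\mathrm{BMO}_\alpha(X)$, $$c\,\|f\|_{\mathrm{BMO}_\alpha}\le\|f\|_{\mathrm{BMO}}\le C\,\|f\|_{\mathrm{BMO}_\alpha}.$$
   Context: **Ball-basis.** Let $(X,\mathfrak M,\mu)$ be a measure space. A family $\mathscr B\subset\mathfrak M$ (its members are called balls) is a ball-basis if: (B1) $0<\mu(B)<\infty$ for every $B\in\mathscr B$; (B2) for any $x,y\in X$ there is a ball containing both $x$ and $y$; (B3) for every $E\in\mathfrak M$ and $\varepsilon>0$ there is a finite or infinite sequence of balls $B_k$ with $\mu(E\triangle\bigcup_kB_k)<\varepsilon$; (B4) for every $B\in\mathscr B$ there is a ball $B^*\in\mathscr B$ (the hull-ball of $B$, fixed once and for all) such that $\bigcup\{A\in\mathscr B:\mu(A)\le2\mu(B),\ A\cap B\ne\varnothing\}\subset B^*$ and $\mu(B^* )\le\mathcal K\mu(B)$, with a constant $\mathcal K>0$ independent of $B$. Doubling: there is $\eta>2$ such that for every ball $B$ with $B^*\ne X$ there is a ball $B'\supset B$ with $2\mu(B)\le\mu(B')\le\eta\mu(B)$. Regular: there is $0<\theta<1$ such that for any balls $A,B$ with $\mu(B)\le\mu(A)$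 and $A\cap B\neq\varnothing$ we have $\mu(B^*\cap A)\ge\theta\mu(B^* )$. **Notation.** $L^0(X)$ is the space of a.e. finite measurable functions. For a measurable set $E$, $\mathrm{OSC}_E(f)=\operatorname{ess\,sup}_{x,x'\in E}|f(x)-f(x')|$; for a ball $B$ and $0<\alpha<1$, $\mathrm{OSC}_{B,\alpha}(f)=\inf\{\mathrm{OSC}_E(f):E\subset B\text{ measurable},\ \mu(E)>\alpha\mu(B)\}$. $\mathrm{BMO}_\alpha(X)$ is the family of $f\in L^0(X)$ with $\|f\|_{\mathrm{BMO}_\alpha}=\sup_{B\in\mathscr B}\mathrm{OSC}_{B,\alpha}(f)<\infty$. $\mathrm{BMO}(X)$ is the family of $f\in L^0(X)$ ($r$-th power integrable on every ball) with $\|f\|_{\mathrm{BMO}}=\sup_{B\in\mathscr B}\big(\frac1{\mu(B)}\int_B|f-f_B|^r\big)^{1/r}<\infty$, where $f_B=\frac1{\mu(B)}\int_Bf$. *)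

(* Defs.v *)
From HB Require Import structures.
From mathcomp Require Import all_boot all_order all_algebra.
From mathcomp Require Import all_classical all_reals all_analysis.
From mathcomp Require Import measurable_realfun.

Set Implicit Arguments.
Unset Strict Implicit.
Unset Printing Implicit Defensive.

Import Order.TTheory GRing.Theory Num.Theory.
Import numFieldNormedType.Exports.

Local Open Scope classical_set_scope.
Local Open Scope ring_scope.
Local Open Scope ereal_scope.

(* The choice of hull-balls [hull B] is part of the data, since doubling and
   regularity refer to it; its values outside [balls] are
   irrelevant. In [bb_approx] the index set [J] lets the sequence of balls be
   infinite, finite, or empty. *)
Record ball_basis (d : measure_display) (R : realType) (X : measurableType d)
    (mu : {measure set X -> \bar R})
    (balls : set (set X)) (hull : set X -> set X) : Prop := BallBasis {
  bb_measurable : forall B, balls B -> measurable B ;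
  bb_measure : forall B, balls B -> 0 < mu B < +oo ;
  bb_cover : forall x y : X, exists2 B, balls B & B x /\ B y ;
  bb_approx : forall (E : set X) (eps : R), measurable E -> (0 < eps)%R ->
    exists (J : set nat) (Bk : nat -> set X),
      (forall k, J k -> balls (Bk k)) /\
      mu (E `+` \bigcup_(k in J) Bk k) < eps%:E ;
  bb_hull_ball : forall B, balls B -> balls (hull B) ;
  bb_hull_sub : forall B, balls B ->
    \bigcup_(A in [set A | [/\ balls A, mu A <= 2%:E * mu B
                             & A `&` B !=set0]]) A `<=` hull B ;
  bb_hull_measure : exists2 K : R, (0 < K)%R &
    forall B, balls B -> mu (hull B) <= K%:E * mu B }.

Definition doubling (d : measure_display) (R : realType) (X : measurableType d)
    (mu : {measure set X -> \bar R})
    (balls : set (set X)) (hull : set X -> set X) : Prop :=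
  exists2 eta : R, (2 < eta)%R &
    forall B, balls B -> hull B <> [set: X] ->
      exists B', [/\ balls B', B `<=` B' &
                     2%:E * mu B <= mu B' <= eta%:E * mu B].

Definition regular (d : measure_display) (R : realType) (X : measurableType d)
    (mu : {measure set X -> \bar R})
    (balls : set (set X)) (hull : set X -> set X) : Prop :=
  exists2 theta : R, (0 < theta < 1)%R &
    forall A B, balls A -> balls B -> mu B <= mu A -> A `&` B !=set0 ->
      theta%:E * mu (hull B) <= mu (hull B `&` A).

Definition L0 (d : measure_display) (R : realType) (X : measurableType d)
    (mu : {measure set X -> \bar R}) : set (X -> \bar R) :=
  [set f : X -> \bar R | measurable_fun [set: X] f /\ {ae mu, forall x, f x \is a fin_num}].

(* The essential supremum over pairs (x, x') in E x E for the product measure.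
   The library's [ess_sup] is unfolded here because it needs a packaged measure
   and [mu \x mu] is packaged as one only for sigma-finite [mu]. *)
Definition OSC (d : measure_display) (R : realType) (X : measurableType d)
    (mu : {measure set X -> \bar R}) (E : set X) (f : X -> \bar R) : \bar R :=
  ereal_inf [set M : \bar R |
    \forall p \ae (mu \x mu), E p.1 -> E p.2 -> `|f p.1 - f p.2| <= M].

Definition OSC_ball (d : measure_display) (R : realType) (X : measurableType d)
    (mu : {measure set X -> \bar R}) (B : set X) (alpha : R)
    (f : X -> \bar R) : \bar R :=
  ereal_inf [set OSC mu E f | E in
    [set E | [/\ measurable E, E `<=` B & alpha%:E * mu B < mu E]]].

Definition BMOa_norm (d : measure_display) (R : realType)
    (X : measurableType d) (mu : {measure set X -> \bar R})
    (balls : set (set X)) (alpha : R) (f : X -> \bar R) : \bar R :=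
  ereal_sup [set OSC_ball mu B alpha f | B in balls].

Definition BMOa (d : measure_display) (R : realType) (X : measurableType d)
    (mu : {measure set X -> \bar R})
    (balls : set (set X)) (alpha : R) : set (X -> \bar R) :=
  [set f | L0 mu f /\ BMOa_norm mu balls alpha f < +oo].

Definition mean (d : measure_display) (R : realType) (X : measurableType d)
    (mu : {measure set X -> \bar R}) (B : set X) (f : X -> \bar R) : \bar R :=
  ((fine (mu B))^-1)%:E * \int[mu]_(x in B) f x.

Definition BMO_norm (d : measure_display) (R : realType) (X : measurableType d)
    (mu : {measure set X -> \bar R})
    (balls : set (set X)) (r : R) (f : X -> \bar R) : \bar R :=
  ereal_sup [set
    (mean mu B (fun x => `|f x - mean mu B f| `^ r)) `^ (r^-1)%R | B in balls].

Definition BMO (d : measure_display) (R : realType) (X : measurableType d)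
    (mu : {measure set X -> \bar R})
    (balls : set (set X)) (r : R) : set (X -> \bar R) :=
  [set f | [/\ L0 mu f,
     forall B, balls B -> mu.-integrable B (fun x => `|f x| `^ r)
     & BMO_norm mu balls r f < +oo]].

(* Main.v *)
Require Import Defs.
From HB Require Import structures.
From mathcomp Require Import all_boot all_order all_algebra.
From mathcomp Require Import all_classical all_reals all_analysis.
From mathcomp Require Import measurable_realfun.
From mathcomp Require Import lra ring.

Set Implicit Arguments.
Unset Strict Implicit.
Unset Printing Implicit Defensive.

Import Order.TTheory GRing.Theory Num.Theory.
Import numFieldNormedType.Exports.

Local Open Scope classical_set_scope.
Local Open Scope ring_scope.
Local Open Scope ereal_scope.

(** The bound of the BMO_alpha norm by the BMO norm is Chebyshev's inequality
    ([OSC_ball_le]): on a ball [B] the set where [f] is far from its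
    mean is small, and [f] oscillates little on the rest of [B].

    The other inequality is a self-improvement of John-Nirenberg type. Put
    beta = 1 - alpha and suppose that the BMO_alpha norm of [f] is below [M].
    By Fubini, every ball [B] has a centre [c] such that |f - c| > M only on a
    part of [B] of measure at most beta mu(B) ([BMOa_center]). The point is that
    the set F_t of points of a ball B0 where |f - c0| > t then satisfies
    mu(F_(t + 2M)) <= q mu(F_t) with a small q ([decay_step]).

    To see this, cover F_t up to a small measure by balls A that F_t fills in a
    proportion at least gamma ([density_cover]; this is where the approximation
    axiom replaces the Lebesgue density theorem). Enlarge each A until a ball of
    twice its measure is no longer filled by F_t in that proportion
    ([maximal_ball]); doubling provides a ball Q, of measure at most K eta mu(A),
    that contains all balls of measure at most 2 mu(A) touching A and that F_t
    fills in a proportion less than gamma ([stopping_hull]). By Vitali's argument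
    finitely many of the A are disjoint while their Q still cover F_t up to a
    small error ([stopping_cover]). Regularity says that at least a proportion
    theta of Q lies in B0. If gamma + beta <= theta, then some point of Q in B0
    is outside F_t and is close to the centre c of Q, so |c - c0| <= M + t
    ([center_near]). Consequently F_(t + 2M) meets Q only where |f - c| > M, that
    is, in a set of measure at most
    beta mu(Q) <= beta K eta mu(A) <= (beta K eta / gamma) mu(F_t meet A),
    and summing over the disjoint A gives the claim with
    q = beta K eta / gamma, which is small when beta is.

    Iterating gives mu(F_((2k + 1) M)) <= q^k mu(B0). If 2^r q <= 1/2 this is
    summable against the values of |f - c0|^r ([integral_powR_layers]) and bounds
    the mean of |f - c0|^r over B0 by a constant times M^r; replacing c0 by the
    mean of f costs another constant ([oscillation_of_moments]).

    All coverings below are finite: a countable cover of a set of finite measure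
    may be truncated at the price of a set of small measure, and this keeps
    disjoint selections and sums elementary. *)

(** * Finite families of measurable sets *)

Lemma lee_sum_seq (R : realType) (I : eqType) (s : seq I) (f g : I -> \bar R) :
  {in s, forall i, f i <= g i} ->
  \sum_(i <- s) f i <= \sum_(i <- s) g i.
Proof.
move=> fg; rewrite big_seq_cond [X in _ <= X]big_seq_cond.
by apply: lee_sum => i /andP[/fg].
Qed.

Section FiniteFamilies.
Context {d : measure_display} {R : realType} {X : measurableType d}.
Context (mu : {measure set X -> \bar R}).

Definition disjointb (A B : set X) : bool := `[< A `&` B = set0 >].

Lemma measure_le_sum_cover (I : eqType) (s : seq I) (H : I -> set X)
    (G : set X) :
  measurable G -> (forall i, i \in s -> measurable (H i)) ->
  G `<=` \bigcup_(i in [set` s]) H i ->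
  mu G <= \sum_(i <- s) mu (G `&` H i).
Proof.
elim: s G => [|i s IHs] G mG mH Gsub.
  have -> : G = set0 by rewrite -subset0 => x /Gsub[].
  by rewrite measure0 big_nil.
have mHi : measurable (H i) by apply: mH; rewrite mem_head.
rewrite big_cons (measureDI mu mG mHi) addeC leeD2l//.
have mHs j : j \in s -> measurable (H j).
  by move=> js; apply: mH; rewrite in_cons js orbT.
apply: le_trans (IHs (G `\` H i) _ mHs _) _.
- exact: measurableD.
- move=> x [/Gsub[j /= + Hjx] nHix].
  by rewrite in_cons => /orP[/eqP ji|js]; [case: nHix; rewrite -ji|exists j].
- apply: lee_sum_seq => j js; apply: le_measure; rewrite ?inE.
  + by apply: measurableI; [exact: measurableD|exact: mHs].
  + by apply: measurableI => //; exact: mHs.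
  + by move=> x [[]].
Qed.

Lemma sum_disjoint_le (s : seq (set X)) (G : set X) :
  measurable G -> {in s, forall A, measurable A} -> pairwise disjointb s ->
  \sum_(A <- s) mu (G `&` A) <= mu G.
Proof.
elim: s G => [|A s IHs] G mG ms /=; first by rewrite big_nil.
move=> /andP[/allP As sdisj].
have mA : measurable A by apply: ms; rewrite mem_head.
have ms' : {in s, forall A, measurable A}.
  by move=> B Bs; apply: ms; rewrite in_cons Bs orbT.
rewrite big_cons (measureDI mu mG mA) addeC leeD2r//.
apply: le_trans _ (IHs (G `\` A) (measurableD mG mA) ms' sdisj).
apply: lee_sum_seq => B Bs; apply: le_measure; rewrite ?inE.
- by apply: measurableI => //; exact: ms'.
- by apply: measurableI; [exact: measurableD|exact: ms'].
- move=> x [Gx Bx]; split=> //; split=> // Ax.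
  by have /asboolP AB0 := As _ Bs; have : (A `&` B) x by []; rewrite AB0.
Qed.

(** Since the family is finite, one may repeatedly take a set of largest measure
    and discard the sets that meet it. *)
Lemma vitali_finite (s : seq (set X)) :
  {in s, forall A, A !=set0} ->
  exists t : seq (set X), [/\ {subset t <= s}, pairwise disjointb t &
    {in s, forall A, exists B, [/\ B \in t, A `&` B !=set0 & mu A <= mu B]}].
Proof.
move=> s0.
pose le_ := fun A B : set X => mu B <= mu A.
have ge_total_mu : total le_ by move=> A B; rewrite /le_ orbC; exact: le_total.
have ge_trans_mu : transitive le_ by move=> A B C AB BC; exact: le_trans BC AB.
(* After sorting, the greedy choice is an induction on the list; the predicate P
   records which sets are disjoint from those already chosen. *)
suff H (u : seq (set X)) (P : pred (set X)) : sorted le_ u ->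
    {in u, forall A, A !=set0} ->
    exists t : seq (set X), [/\ {subset t <= u}, all P t, pairwise disjointb t &
    {in u, forall A, P A ->
      exists B, [/\ B \in t, A `&` B !=set0 & mu A <= mu B]}].
  have [||t [ts _ dt ct]] := H (sort le_ s) predT; first exact: sort_sorted.
    by move=> A; rewrite mem_sort; exact: s0.
  exists t; split=> //; first by move=> A /ts; rewrite mem_sort.
  by move=> A As; apply: ct; rewrite ?mem_sort.
elim: u P => [|A u IHu] P su u0; first by exists [::]; split.
have Au : all (le_ A) u by apply: (order_path_min ge_trans_mu).
have u0' : {in u, forall A, A !=set0}.
  by move=> B Bu; apply: u0; rewrite in_cons Bu orbT.
have su' := path_sorted su.
have [PA|nPA] := boolP (P A); last first.
  have [t [tu Pt dt ct]] := IHu P su' u0'.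
  exists t; split=> //; first by move=> B /tu; rewrite in_cons => ->; rewrite orbT.
  move=> B; rewrite in_cons => /orP[/eqP->|]; first by rewrite (negbTE nPA).
  exact: ct.
have [t [tu Pt dt ct]] := IHu (fun B => P B && disjointb A B) su' u0'.
exists (A :: t); split.
- move=> B; rewrite !in_cons => /orP[->//|/tu ->]; exact: orbT.
- by rewrite /= PA /=; apply: sub_all Pt => B /andP[].
- by rewrite /= dt andbT; apply: sub_all Pt => B /andP[].
- have A0 : A !=set0 by apply: u0; rewrite mem_head.
  move=> B; rewrite in_cons => /orP[/eqP-> _|Bu PB].
    by exists A; rewrite mem_head setIid.
  have [AB|nAB] := boolP (disjointb A B).
    have [|C [Ct BC leBC]] := ct _ Bu; first by rewrite PB.
    by exists C; rewrite in_cons Ct orbT.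
  exists A; rewrite mem_head setIC; split=> //; last exact: (allP Au).
  by apply/set0P/eqP => AB0; move/asboolP: nAB.
Qed.

Lemma measure_le_diff_of_sparse (F A : set X) (gam : R) : measurable F -> measurable A ->
  mu A \is a fin_num -> (gam < 1)%R -> mu (F `&` A) < gam%:E * mu A ->
  mu A <= (1 - gam)^-1%:E * mu (A `\` F).
Proof.
move=> mF mA finA gam1.
have eA : mu A = mu (A `\` F) + mu (A `&` F) by exact: measureDI.
have /andP[finD finI] : (mu (A `\` F) \is a fin_num) &&
    (mu (A `&` F) \is a fin_num) by rewrite -fin_numD -eA.
rewrite setIC; move: eA.
rewrite -(fineK finA) -(fineK finD) -(fineK finI) -!EFinM -EFinD lte_fin.
by rewrite lee_fin => -[eA] nA; rewrite ler_pdivlMl ?subr_gt0//; lra.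
Qed.

End FiniteFamilies.

(** * Covering by balls *)

Section BallBasis.
Context {d : measure_display} {R : realType} {X : measurableType d}.
Context (mu : {measure set X -> \bar R}) (balls : set (set X))
  (hull : set X -> set X) (hb : ball_basis mu balls hull).

Local Notation "\cup s" := (\bigcup_(A in [set` s]) A) (at level 10).

Lemma ball_fin B : balls B -> mu B \is a fin_num.
Proof. by move=> /(bb_measure hb)/andP[B0 Boo]; rewrite ge0_fin_numE. Qed.

Lemma ball_neq0 B : balls B -> B !=set0.
Proof.
move=> /(bb_measure hb)/andP[B0 _]; apply/set0P/eqP => BE.
by rewrite BE measure0 ltxx in B0.
Qed.

Lemma measurable_cups (s : seq (set X)) : {in s, forall A, balls A} -> measurable (\cup s).
Proof.
move=> bs; apply: fin_bigcup_measurable => //= A As.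
by apply: (bb_measurable hb); exact: bs.
Qed.

Lemma sub_hull (A B : set X) : balls A -> balls B -> A `&` B !=set0 ->
  mu A <= 2%:E * mu B -> A `<=` hull B.
Proof.
move=> bA bB AB leAB x Ax; apply: (bb_hull_sub hb bB); by exists A.
Qed.

Lemma le_double (x : \bar R) : 0 <= x -> x <= 2%:E * x.
Proof. by move=> x0; rewrite -{1}[x]mul1e lee_wpmul2r// lee_fin; lra. Qed.

Lemma finite_approx (E : set X) (eps : R) : measurable E -> mu E < +oo ->
  (0 < eps)%R -> exists s : seq (set X), [/\ {in s, forall A, balls A},
    mu (E `\` \cup s) < eps%:E & mu (\cup s `\` E) < eps%:E].
Proof.
move=> mE Eoo eps0; have [J [Bk [bB lt]]] := bb_approx hb mE eps0.
pose s n := [seq Bk k | k <- iota 0 n & `[< J k >]].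
have bs n : {in s n, forall A, balls A}.
  by move=> A /mapP[k]; rewrite mem_filter => /andP[/asboolP Jk _] ->; exact: bB.
have sU n : \cup (s n) `<=` \bigcup_(k in J) Bk k.
  move=> x [A /= /mapP[k]]; rewrite mem_filter => /andP[/asboolP Jk _] -> ?.
  by exists k.
have mU : measurable (\bigcup_(k in J) Bk k).
  by apply: bigcup_measurable => k Jk; apply: (bb_measurable hb); exact: bB.
have mEs n : measurable (E `\` \cup (s n)).
  by apply: measurableD => //; exact: measurable_cups.
have capE : \bigcap_n (E `\` \cup (s n)) = E `\` \bigcup_(k in J) Bk k.
  apply/seteqP; split=> x /=.
    move=> h; split; first by have [] := h 0%N I.
    move=> [k Jk Bx]; have [_] := h k.+1 I; apply; exists (Bk k) => //=.
    apply/mapP; exists k => //; rewrite mem_filter mem_iota /= add0n ltnSn andbT.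
    exact/asboolP.
  by move=> [Ex nU] n _; split=> // /sU.
have : mu (E `\` \cup (s n)) @[n --> \oo] --> mu (E `\` \bigcup_(k in J) Bk k).
  rewrite -capE; apply: nonincreasing_cvg_mu => //.
  - by apply: le_lt_trans Eoo; apply: le_measure; rewrite ?inE//; apply: subDsetl.
  - by rewrite capE; exact: measurableD.
  - apply/nonincreasing_seqP => n; apply/subsetPset; apply: setDS.
    apply: bigcup_sub => A As x Ax; exists A => //=; move/mapP: As => [k kn ->].
    by apply: map_f; move: kn; rewrite !mem_filter !mem_iota !add0n /=
      => /andP[->] /= kn; rewrite ltnS ltnW.
have lt1 : mu (E `\` \bigcup_(k in J) Bk k) < eps%:E.
  apply: le_lt_trans lt; apply: le_measure; rewrite ?inE.
  - exact: measurableD.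
  - by apply: measurableU; exact: measurableD.
  - by move=> x; left.
move=> cvmu; have : nbhs (mu (E `\` \bigcup_(k in J) Bk k)) [set y | y < eps%:E].
  by apply: open_nbhs_nbhs; split => //; exact: open_ereal_lt_ereal.
move=> /cvmu [n _ /(_ n (leqnn n)) /= hn].
exists (s n); split => //.
apply: le_lt_trans lt; apply: le_measure; rewrite ?inE.
- by apply: measurableD => //; exact: measurable_cups.
- by apply: measurableU; exact: measurableD.
- by move=> x [/sU Ux nE]; right.
Qed.

(** A substitute for the Lebesgue density theorem. Approximate [F] by a union of
    balls; the balls that [F] does not fill in proportion [gam] waste most of
    their measure outside [F], hence, by the Vitali selection, their union is
    controlled by the error of the approximation and may be dropped. *)
Lemma density_cover (F : set X) (gam eps : R) : measurable F -> mu F < +oo ->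
  (0 < gam < 1)%R -> (0 < eps)%R -> exists s : seq (set X),
  [/\ {in s, forall A, balls A},
      {in s, forall A, gam%:E * mu A <= mu (F `&` A)} &
      mu (F `\` \cup s) < eps%:E].
Proof.
move=> mF Foo /andP[gam0 gam1] eps0.
have [K K0 hK] := bb_hull_measure hb.
have c0 : (0 < K / (1 - gam))%R by rewrite divr_gt0// subr_gt0.
(* The error is at most del for the approximation and K / (1 - gam) del for the
   dropped balls. *)
pose del : R := (eps / (1 + K / (1 - gam)))%R.
have del0 : (0 < del)%R by rewrite divr_gt0// addr_gt0.
have [s [bs lt1 lt2]] := finite_approx mF Foo del0.
pose good A := gam%:E * mu A <= mu (F `&` A).
pose bad := [seq A <- s | ~~ good A].
have bbad : {in bad, forall A, balls A}.
  by move=> A; rewrite mem_filter => /andP[_]; exact: bs.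
have [|t [tb dt ct]] := @vitali_finite _ _ _ mu bad.
  by move=> A /bbad; exact: ball_neq0.
have bt : {in t, forall A, balls A} by move=> A /tb; exact: bbad.
have mS : measurable (\cup s `\` F) by apply: measurableD => //; exact: measurable_cups.
have mhull A : A \in t -> measurable (hull A).
  by move=> At; apply: (bb_measurable hb); apply: (bb_hull_ball hb); exact: bt.
exists [seq A <- s | good A]; split.
- by move=> A; rewrite mem_filter => /andP[_]; exact: bs.
- by move=> A; rewrite mem_filter => /andP[].
have badle : mu (\cup bad) <= (K / (1 - gam) * del)%:E.
  apply: (@le_trans _ _ (\sum_(A <- t) mu (hull A))).
    apply: le_trans (measure_le_sum_cover (H := hull) (s := t) _ _ _ _) _.
    - exact: measurable_cups.
    - exact: mhull.
    - move=> x [A /= Abad Ax]; have [B [Bt AB leAB]] := ct _ Abad.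
      exists B => //; apply: (@sub_hull A B) => //; [exact: bbad|exact: bt|].
      by apply: (le_trans leAB); exact: le_double.
    apply: lee_sum_seq => A At; apply: le_measure; rewrite ?inE//.
    + by apply: measurableI; [exact: measurable_cups|exact: mhull].
    + exact: mhull.
  apply: (@le_trans _ _ (\sum_(A <- t)
      (K / (1 - gam))%:E * mu ((\cup s `\` F) `&` A))).
    apply: lee_sum_seq => A At; apply: le_trans (hK _ (bt _ At)) _.
    have /andP[As nA] : (A \in s) && ~~ good A.
      by have := tb _ At; rewrite mem_filter andbC.
    have mA := bb_measurable hb (bs _ As).
    have -> : (\cup s `\` F) `&` A = A `\` F.
      apply/seteqP; split=> x /=; first by move=> [[]].
      by move=> [Ax nFx]; do !split=> //; exists A.
    have finA := ball_fin (bs _ As).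
    move: nA; rewrite /good -ltNge => nA.
    rewrite EFinM -muleA; apply: lee_wpmul2l; first by rewrite lee_fin ltW.
    exact: measure_le_diff_of_sparse.
  rewrite -ge0_sume_distrr; last by move=> *; exact: measure_ge0.
  rewrite [leRHS]EFinM; apply: lee_wpmul2l; first by rewrite lee_fin ltW.
  apply: le_trans (ltW lt2); apply: sum_disjoint_le => //.
  by move=> A At; apply: (bb_measurable hb); exact: bt.
apply: (@le_lt_trans _ _ (mu (F `\` \cup s) + mu (\cup bad))).
  apply: le_trans (measureU2 _ _ _).
  + apply: le_measure; rewrite ?inE.
    * apply: measurableD => //; apply: measurable_cups => A.
      by rewrite mem_filter => /andP[_]; exact: bs.
    * apply: measurableU; [apply: measurableD => //|]; exact: measurable_cups.
    * move=> x [Fx nx]; have [xs|xs] := pselect ((\cup s) x); last by left.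
      right; move: xs => [A /= As Ax]; exists A => //=.
      rewrite mem_filter As andbT; apply/negP => gA; apply: nx.
      by exists A => //=; rewrite mem_filter As gA.
  + by apply: measurableD => //; exact: measurable_cups.
  + exact: measurable_cups.
apply: (@lt_le_trans _ _ (del%:E + (K / (1 - gam) * del)%:E)).
  apply: lte_leD => //; rewrite ge0_fin_numE//.
  by apply: le_lt_trans badle _; exact: ltry.
rewrite -EFinD lee_fin /del -[X in (X + _)%R]mul1r -mulrDl mulrC divfK//.
by rewrite gt_eqF// addr_gt0.
Qed.

(** Passing from a ball to a ball of at least twice its measure can be repeated
    only finitely often, because a ball that [F] fills in proportion [gam] has
    measure at most mu(F) / gam. *)
Lemma maximal_ball (F : set X) (gam : R) (B : set X) : measurable F ->
  mu F < +oo -> (0 < gam)%R -> balls B -> gam%:E * mu B <= mu (F `&` B) ->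
  exists A, [/\ balls A, B `<=` A, gam%:E * mu A <= mu (F `&` A) &
    forall Q, balls Q -> A `<=` Q -> 2%:E * mu A <= mu Q ->
      mu (F `&` Q) < gam%:E * mu Q].
Proof.
move=> mF Foo gam0 bB.
have leF C : balls C -> mu (F `&` C) <= mu F.
  move=> bC; have mC := bb_measurable hb bC.
  by apply: le_measure; rewrite ?inE//; exact: measurableI.
have [n hn] : exists n, mu F < (gam * 2 ^+ n)%:E * mu B.
  have /andP[] := bb_measure hb bB.
  have : 0 <= mu F by []; case: (mu F) Foo => // m _.
  case: (mu B) => // b; rewrite lee_fin lte_fin => m0 b0 _.
  exists (Num.bound (m / (gam * b))); rewrite -EFinM lte_fin.
  rewrite mulrAC -ltr_pdivrMl ?mulr_gt0// mulrC.
  apply: lt_le_trans (archi_boundP _) _; first by rewrite divr_ge0// mulr_ge0// ltW.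
  by rewrite -natrX ler_nat ltnW// ltn_expl.
elim: n B bB hn => [|n IHn] B bB hn gB.
  rewrite expr0 mulr1 in hn.
  by have := lt_le_trans hn (le_trans gB (leF _ bB)); rewrite ltxx.
have [maxB|] := pselect (forall Q, balls Q -> B `<=` Q -> 2%:E * mu B <= mu Q ->
      mu (F `&` Q) < gam%:E * mu Q); first by exists B; split.
move=> /existsNP[Q] /not_implyP[bQ] /not_implyP[BQ] /not_implyP[leQ].
move=> /negP; rewrite -leNgt => gQ.
have [|A [bA QA gA maxA]] := IHn Q bQ _ gQ.
  apply: lt_le_trans hn _; rewrite exprSr mulrA EFinM -muleA.
  by apply: lee_wpmul2l => //; rewrite lee_fin mulr_ge0// ?exprn_ge0// ltW.
by exists A; split => //; exact: subset_trans QA.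
Qed.

(** The ball [Q] is the hull of a ball B' provided by doubling. Doubling applies,
    for if the hull of [A] were the whole space, then mu(B0) <= K mu(A), and [F]
    would fill too much of [B0]. Regularity applies to B' and [B0] because
    mu(B') <= eta mu(F) / gam <= mu(B0). *)
Lemma stopping_hull (K eta theta gam : R) (F B0 A : set X) :
  (0 < K)%R -> (0 < eta)%R -> (0 < gam)%R ->
  (forall B, balls B -> mu (hull B) <= K%:E * mu B) ->
  (forall B, balls B -> hull B <> [set: X] -> exists B',
    [/\ balls B', B `<=` B' & 2%:E * mu B <= mu B' <= eta%:E * mu B]) ->
  (forall A B, balls A -> balls B -> mu B <= mu A -> A `&` B !=set0 ->
    theta%:E * mu (hull B) <= mu (hull B `&` A)) ->
  balls B0 -> measurable F -> F `<=` B0 ->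
  eta%:E * mu F <= gam%:E * mu B0 -> K%:E * mu F < gam%:E * mu B0 ->
  balls A -> gam%:E * mu A <= mu (F `&` A) ->
  (forall Q, balls Q -> A `<=` Q -> 2%:E * mu A <= mu Q ->
      mu (F `&` Q) < gam%:E * mu Q) ->
  exists Q, [/\ balls Q, forall A', balls A' -> A' `&` A !=set0 ->
      mu A' <= 2%:E * mu A -> A' `<=` Q,
      mu Q <= (K * eta)%:E * mu A, mu (F `&` Q) < gam%:E * mu Q &
      theta%:E * mu Q <= mu (Q `&` B0)].
Proof.
move=> K0 eta0 gam0 hK hd hreg bB0 mF FB0 etaF KF bA gA maxA.
have mA := bb_measurable hb bA.
have mB0 := bb_measurable hb bB0.
have gAF : gam%:E * mu A <= mu F.
  by apply: le_trans gA _; apply: le_measure; rewrite ?inE//; exact: measurableI.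
have hA : hull A <> [set: X].
  move=> hAT; have := hK _ bA; rewrite hAT => KA.
  suff : gam%:E * mu B0 <= K%:E * mu F by rewrite leNgt KF.
  apply: (@le_trans _ _ (gam%:E * (K%:E * mu A))).
    apply: lee_wpmul2l; first by rewrite lee_fin ltW.
    by apply: le_trans KA; apply: le_measure; rewrite ?inE.
  by rewrite muleCA; apply: lee_wpmul2l => //; rewrite lee_fin ltW.
have [B' [bB' AB' /andP[leB' B'le]]] := hd _ bA hA.
have self : B' `<=` hull B'.
  apply: (@sub_hull B' B') => //; last exact: le_double.
  by rewrite setIid; exact: ball_neq0.
have bQ : balls (hull B') := bb_hull_ball hb bB'.
have mB' := bb_measurable hb bB'.
have mQ := bb_measurable hb bQ.
have leAB' : mu A <= mu B' by apply: le_measure; rewrite ?inE.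
exists (hull B'); split => //.
- move=> A' bA' A'A leA'; apply: (@sub_hull A' B') => //.
    by case: A'A => x [? ?]; exists x; split => //; exact: AB'.
  by apply: le_trans leA' (le_trans leB' _); exact: le_double.
- apply: le_trans (hK _ bB') _; rewrite EFinM -muleA.
  by apply: lee_wpmul2l => //; rewrite lee_fin ltW.
- apply: maxA => //; first exact: subset_trans self.
  by apply: le_trans leB' _; apply: le_measure; rewrite ?inE.
- apply: hreg => //.
    rewrite -(@lee_pmul2l _ gam%:E) ?lte_fin//.
    apply: le_trans etaF; apply: (@le_trans _ _ (gam%:E * (eta%:E * mu A))).
      by apply: lee_wpmul2l => //; rewrite lee_fin ltW.
    by rewrite muleCA; apply: lee_wpmul2l => //; rewrite lee_fin ltW.
  have [x [Fx Ax]] : F `&` A !=set0.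
    apply/set0P/eqP => FA0; move: gA; rewrite FA0 measure0 leNgt.
    by rewrite mule_gt0 ?lte_fin//; have /andP[] := bb_measure hb bA.
  by exists x; split; [exact: FB0|exact: AB'].
Qed.

(** The Calderon-Zygmund decomposition of [F]: the disjoint sets [A] carry a fixed
    proportion of the measure of their enlargements [Q A], which cover [F] up to
    [eps] and, being larger than the stopping balls, are no longer filled by [F]
    in the proportion [gam]. *)
Lemma stopping_cover (K eta theta gam eps : R) (F B0 : set X) :
  (0 < K)%R -> (0 < eta)%R -> (0 < gam < 1)%R -> (0 < eps)%R ->
  (forall B, balls B -> mu (hull B) <= K%:E * mu B) ->
  (forall B, balls B -> hull B <> [set: X] -> exists B',
    [/\ balls B', B `<=` B' & 2%:E * mu B <= mu B' <= eta%:E * mu B]) ->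
  (forall A B, balls A -> balls B -> mu B <= mu A -> A `&` B !=set0 ->
    theta%:E * mu (hull B) <= mu (hull B `&` A)) ->
  balls B0 -> measurable F -> F `<=` B0 ->
  eta%:E * mu F <= gam%:E * mu B0 -> K%:E * mu F < gam%:E * mu B0 ->
  exists (s : seq (set X)) (Q : set X -> set X),
    [/\ {in s, forall A, measurable A}, pairwise disjointb s,
      {in s, forall A, [/\ balls (Q A), gam%:E * mu A <= mu (F `&` A),
        mu (Q A) <= (K * eta)%:E * mu A, mu (F `&` Q A) < gam%:E * mu (Q A) &
        theta%:E * mu (Q A) <= mu (Q A `&` B0)]} &
      mu (F `\` \bigcup_(A in [set` s]) Q A) < eps%:E].
Proof.
move=> K0 eta0 /andP[gam0 gam1] eps0 hK hd hreg bB0 mF FB0 etaF KF.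
have Foo : mu F < +oo.
  apply: (@le_lt_trans _ _ (mu B0)); last by have /andP[] := bb_measure hb bB0.
  by apply: le_measure; rewrite ?inE//; exact: (bb_measurable hb).
have [|s0 [bs0 gs0 cs0]] := density_cover (gam := gam) mF Foo _ eps0; first exact/andP.
pose maximal A := forall Q, balls Q -> A `<=` Q -> 2%:E * mu A <= mu Q ->
      mu (F `&` Q) < gam%:E * mu Q.
have [M hM] : {M : set X -> set X & forall B, B \in s0 ->
    [/\ balls (M B), B `<=` M B, gam%:E * mu (M B) <= mu (F `&` M B)
     & maximal (M B)]}.
  apply: (@choice _ _ (fun B A => B \in s0 -> [/\ balls A, B `<=` A,
     gam%:E * mu A <= mu (F `&` A) & maximal A])) => B.
  have [Bs|] := boolP (B \in s0); last by exists B.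
  by have [A ?] := maximal_ball mF Foo gam0 (bs0 _ Bs) (gs0 _ Bs); exists A.
have bM : {in [seq M B | B <- s0], forall A,
   [/\ balls A, gam%:E * mu A <= mu (F `&` A) & maximal A]}.
  by move=> _ /mapP[B Bs ->]; have [] := hM _ Bs.
have [|t [ts dt ct]] := @vitali_finite _ _ _ mu [seq M B | B <- s0].
  by move=> A /bM[bA _ _]; exact: ball_neq0 bA.
have [Q hQ] : {Q : set X -> set X & forall A, A \in t ->
    [/\ balls (Q A), forall A', balls A' -> A' `&` A !=set0 ->
      mu A' <= 2%:E * mu A -> A' `<=` Q A,
      mu (Q A) <= (K * eta)%:E * mu A, mu (F `&` Q A) < gam%:E * mu (Q A) &
      theta%:E * mu (Q A) <= mu (Q A `&` B0)]}.
  apply: (@choice _ _ (fun A Q => A \in t ->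
    [/\ balls Q, forall A', balls A' -> A' `&` A !=set0 ->
      mu A' <= 2%:E * mu A -> A' `<=` Q,
      mu Q <= (K * eta)%:E * mu A, mu (F `&` Q) < gam%:E * mu Q &
      theta%:E * mu Q <= mu (Q `&` B0)])) => A.
  have [At|] := boolP (A \in t); last by exists A.
  have [bA gA maxA] := bM _ (ts _ At).
  have [Q hQ] := stopping_hull K0 eta0 gam0 hK hd hreg bB0 mF FB0 etaF KF bA gA maxA.
  by exists Q.
exists t, Q; split => //.
- by move=> A /ts/bM[bA _ _]; exact: (bb_measurable hb).
- by move=> A At; have [? _ ? ? ?] := hQ _ At; have [_ ? _] := bM _ (ts _ At).
- apply: le_lt_trans cs0; apply: le_measure; rewrite ?inE.
  + apply: measurableD => //; apply: fin_bigcup_measurable => //= A At.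
    by have [bQ _ _ _ _] := hQ _ At; exact: (bb_measurable hb).
  + by apply: measurableD => //; exact: measurable_cups.
  + move=> x [Fx nx]; split=> // -[B /= Bs Bx]; apply: nx.
    have [bMB BMB _ _] := hM _ Bs.
    have [A [At MA leMA]] := ct _ (map_f M Bs).
    exists A => //; have [_ sQ _ _ _] := hQ _ At.
    by apply: (sQ (M B)) => //; [exact: le_trans leMA (le_double _)|exact: BMB].
Qed.

End BallBasis.

(** * Integrals of functions with geometrically decaying distribution *)

Section Layers.
Context {d : measure_display} {R : realType} {X : measurableType d}.
Context (mu : {measure set X -> \bar R}).

(** On the layer (2k + 1) M < v <= (2k + 3) M the value of v is at most 3 2^k M. *)
Lemma powR_layers (M p v : R) (n : nat) : (0 < M)%R -> (0 <= p)%R ->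
  (0 <= v)%R -> (v <= (2 * n%:R + 1) * M)%R ->
  (v `^ p <= M `^ p + \sum_(0 <= k < n)
     (3 * 2 ^+ k * M) `^ p * ((2 * k%:R + 1) * M < v)%R%:R)%R.
Proof.
move=> M0 p0 v0; elim: n => [|n IHn] vn.
  rewrite big_nil addr0 ge0_ler_powR// ?nnegrE ?(ltW M0)//; lra.
rewrite big_nat_recr//= addrA.
have [vn'|ltv] := leP v ((2 * n%:R + 1) * M)%R.
  by rewrite mulr0 addr0; exact: IHn.
rewrite mulr1 -[leLHS]add0r lerD//.
  rewrite addr_ge0 ?powR_ge0// sumr_ge0// => k _.
  by rewrite mulr_ge0 ?powR_ge0.
rewrite ge0_ler_powR ?nnegrE ?mulr_ge0 ?exprn_ge0 ?(ltW M0)//.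
apply: le_trans vn _; rewrite ler_pM2r//.
have : (n.+1%:R <= 2 ^+ n :> R)%R by rewrite -natrX ler_nat ltn_expl.
have : (1 <= n.+1%:R :> R)%R by rewrite ler1n.
by rewrite -addn1 natrD; lra.
Qed.

(** The layers contribute (3 2^k M)^p q^k <= 3^p M^p 2^(-k), whose sum over k
    is 2 3^p M^p; the first term comes from the values up to [M]. *)
Lemma integral_powR_layers (B : set X) (h : X -> \bar R) (M p q : R) :
  measurable B -> mu B \is a fin_num ->
  measurable_fun B h -> (forall x, 0 <= h x) ->
  {ae mu, forall x, h x \is a fin_num} ->
  (0 < M)%R -> (0 <= p)%R -> (0 <= q)%R -> (2 `^ p * q <= 2^-1)%R ->
  (forall k : nat, mu (B `&` [set x | ((2 * k%:R + 1) * M)%:E < h x])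
     <= (q ^+ k)%:E * mu B) ->
  \int[mu]_(x in B) (h x `^ p) <= ((1 + 2 * 3 `^ p) * M `^ p)%:E * mu B.
Proof.
move=> mB fB mh h0 hfin M0 p0 q0 hq decay.
pose F k := B `&` [set x | ((2 * k%:R + 1) * M)%:E < h x].
pose a k : R := ((3 * 2 ^+ k * M) `^ p)%R.
have mF k : measurable (F k) by exact: emeasurable_fun_o_infty.
have a0 k : (0 <= a k)%R by exact: powR_ge0.
pose g k x := (a k)%:E * (\1_(F k) x)%:E.
have g0 k x : 0 <= g k x by rewrite /g mule_ge0// lee_fin.
have mg k : measurable_fun B (g k).
  apply: measurable_funeM; apply/measurable_EFinP.
  by apply: measurable_indic.
have ptw : {ae mu, forall x, B x -> h x `^ p <= (M `^ p)%:E + \sum_(k <oo) g k x}.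
  apply: filterS hfin => x hx Bx; have := h0 x; have := fineK hx.
  set v := fine (h x) => hv; rewrite -hv lee_fin poweR_EFin => v0.
  pose n := Num.bound (v / M).
  have vn : (v <= (2 * n%:R + 1) * M)%R.
    rewrite -ler_pdivrMr//; apply: ltW.
    apply: lt_le_trans (archi_boundP _) _; first by rewrite divr_ge0// ltW.
    by rewrite -/n; have : (0 <= n%:R :> R)%R by []; lra.
  apply: (@le_trans _ _ ((M `^ p)%:E + \sum_(0 <= k < n) g k x)); last first.
    by rewrite leeD2l//; apply: nneseries_lim_ge.
  apply: (@le_trans _ _ (_)%:E); first by rewrite lee_fin; exact: powR_layers vn.
  rewrite EFinD leeD2l// -sumEFin; apply: lee_sum => k _.
  rewrite /g -EFinM lee_fin /a ler_wpM2l ?powR_ge0// indicE.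
  have -> : (x \in F k) = ((2 * k%:R + 1) * M < v)%R.
    apply/idP/idP; rewrite inE /F /= -hv lte_fin; first by case.
    by split.
  by [].
have mS : measurable_fun B (fun x => \sum_(k <oo) g k x).
  by apply: ge0_emeasurable_sum.
have S0 x : 0 <= \sum_(k <oo) g k x by exact: nneseries_ge0.
apply: (@le_trans _ _ (\int[mu]_(x in B) ((M `^ p)%:E + \sum_(k <oo) g k x))).
  apply: ae_ge0_le_integral => //.
  - by move=> x _; exact: poweR_ge0.
  - exact: measurableT_comp (measurable_poweR p) mh.
  - by move=> x _; rewrite adde_ge0// lee_fin powR_ge0.
  - by apply: emeasurable_funD.
rewrite ge0_integralD//; last by move=> x _; rewrite lee_fin powR_ge0.
rewrite integral_cst// integral_nneseries//.
have geo : \sum_(k <oo) ((2 * 3 `^ p * M `^ p) / (2 ^ (k + 1))%:R)%:E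
    = (2 * 3 `^ p * M `^ p)%:E.
  apply/cvg_lim => //; have := @cvg_geometric_eseries_half R (2 * 3 `^ p * M `^ p) 0.
  by rewrite expr0 divr1.
rewrite mulrDl mul1r EFinD ge0_muleDl ?lee_fin ?mulr_ge0 ?powR_ge0//.
rewrite leeD2l// -geo [leRHS]muleC -(fineK fB) -nneseriesZl; last first.
  by move=> i _; rewrite lee_fin divr_ge0 ?mulr_ge0 ?powR_ge0.
have c0 : (0 <= 2 * 3 `^ p * M `^ p :> R)%R by rewrite !mulr_ge0 ?powR_ge0.
apply: lee_nneseries => k _; first by rewrite integral_ge0.
rewrite ge0_integralZl_EFin//; last first.
  by apply/measurable_EFinP; exact: measurable_indic.
rewrite integral_indic// setIidl; last by move=> x [].
apply: (@le_trans _ _ ((a k)%:E * ((q ^+ k)%:E * (fine (mu B))%:E))).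

  by apply: lee_wpmul2l; [rewrite lee_fin|rewrite fineK//; exact: decay].
rewrite -!EFinM lee_fin mulrA mulrC ler_wpM2l ?fine_ge0//.
rewrite /a !powRM ?mulr_ge0 ?exprn_ge0 ?(ltW M0)//.
have -> : ((2 ^+ k) `^ p = (2 `^ p) ^+ k :> R)%R.
  by rewrite -!powR_mulrn ?powR_ge0// -!powRrM mulrC.
have hk : ((2 `^ p) ^+ k * q ^+ k <= 2^-1 ^+ k :> R)%R.
  by rewrite -exprMn lerXn2r ?nnegrE ?mulr_ge0 ?powR_ge0.
apply: (@le_trans _ _ (3 `^ p * M `^ p * ((2 `^ p) ^+ k * q ^+ k))%R).
  by rewrite le_eqVlt; apply/orP; left; apply/eqP; ring.
apply: le_trans (ler_wpM2l _ hk) _; first by rewrite mulr_ge0 ?powR_ge0.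
rewrite natrX exprD expr1 exprVn le_eqVlt; apply/orP; left; apply/eqP.
by field; rewrite expf_neq0.
Qed.
End Layers.

(** * Geometric decay of the distribution of f around a centre *)

Lemma dev_shift (R : realType) (v : \bar R) (a b s t : R) :
  `|v - a%:E| <= s%:E -> `|v - b%:E| <= t%:E -> (`|a - b| <= s + t)%R.
Proof.
case: v => [v| |] //=; rewrite ?lee_fin => va vb.
have -> : (a - b = - (v - a) + (v - b))%R by ring.
by rewrite (le_trans (ler_normD _ _))// normrN lerD.
Qed.

Lemma dev_le (R : realType) (v : \bar R) (a b s t : R) :
  `|v - a%:E| <= s%:E -> (`|a - b| <= t)%R -> `|v - b%:E| <= (s + t)%:E.
Proof.
case: v => [v| |] //=; rewrite ?lee_fin => va ab.
have -> : (v - b = (v - a) + (a - b))%R by ring.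
by rewrite (le_trans (ler_normD _ _))// lerD.
Qed.

Section Decay.
Context {d : measure_display} {R : realType} {X : measurableType d}.
Context (mu : {measure set X -> \bar R}) (balls : set (set X))
  (hull : set X -> set X) (hb : ball_basis mu balls hull).
Context (f : X -> \bar R) (mf : measurable_fun [set: X] f).

Definition dev (c t : R) : set X := [set x | t%:E < `|f x - c%:E|].

Lemma measurable_dev_fun c : measurable_fun [set: X] (fun x => `|f x - c%:E|).
Proof.
by apply: measurableT_comp => //; apply: emeasurable_funB => //; exact: measurable_cst.
Qed.

Lemma measurable_dev c t : measurable (dev c t).
Proof.
rewrite -[dev _ _]setTI; apply: emeasurable_fun_o_infty => //.
exact: measurable_dev_fun.
Qed.

Context (K eta theta gam bet q M : R).
Context (K0 : (0 < K)%R) (eta0 : (0 < eta)%R) (gam01 : (0 < gam < 1)%R)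
  (bet0 : (0 <= bet)%R)
  (M0 : (0 <= M)%R)
  (hK : forall B, balls B -> mu (hull B) <= K%:E * mu B)
  (hd : forall B, balls B -> hull B <> [set: X] -> exists B',
    [/\ balls B', B `<=` B' & 2%:E * mu B <= mu B' <= eta%:E * mu B])
  (hreg : forall A B, balls A -> balls B -> mu B <= mu A -> A `&` B !=set0 ->
    theta%:E * mu (hull B) <= mu (hull B `&` A))
  (gam_bet : (gam + bet <= theta)%R)
  (bet_eta : (eta * bet <= gam)%R) (bet_K : (K * bet < gam)%R)
  (bet_q : (bet * (K * eta) <= q * gam)%R)
  (hosc : forall B, balls B -> exists c, mu (B `&` dev c M) <= bet%:E * mu B).

(** A sparse set and the exceptional set of [Q] together cannot fill the part of
    [Q] inside [B0], so some point of that part is close to both centres. *)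
Lemma center_near (Q B0 : set X) (c0 t : R) : balls Q -> balls B0 ->
  mu (B0 `&` dev c0 t `&` Q) < gam%:E * mu Q ->
  theta%:E * mu Q <= mu (Q `&` B0) ->
  exists c, mu (Q `&` dev c M) <= bet%:E * mu Q /\ (`|c - c0| <= M + t)%R.
Proof.
move=> bQ bB0 sparse thick; have [c hc] := hosc bQ; exists c; split => //.
have mQ := bb_measurable hb bQ; have mB0 := bb_measurable hb bB0.
have [x [Qx B0x xc xc0]] : exists x, [/\ Q x, B0 x,
    `|f x - c%:E| <= M%:E & `|f x - c0%:E| <= t%:E].
  apply: contrapT => nex.
  have sub : Q `&` B0 `<=` (B0 `&` dev c0 t `&` Q) `|` (Q `&` dev c M).
    move=> x [Qx B0x]; apply: contrapT => /not_orP[n1 n2]; apply: nex.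
    exists x; split => //.
      by rewrite leNgt; apply/negP => lt; apply: n2.
    by rewrite leNgt; apply/negP => lt; apply: n1.
  have m1 : measurable (B0 `&` dev c0 t `&` Q).
    by apply: measurableI => //; apply: measurableI => //; exact: measurable_dev.
  have m2 : measurable (Q `&` dev c M).
    by apply: measurableI => //; exact: measurable_dev.
  have le1 : mu (Q `&` B0) <= mu (B0 `&` dev c0 t `&` Q) + mu (Q `&` dev c M).
    apply: le_trans (measureU2 _ m1 m2); apply: le_measure; rewrite ?inE//.
      exact: measurableI.
    exact: measurableU.
  have := le_lt_trans le1 (lte_leD _ sparse hc).
  have -> : mu (Q `&` dev c M) \is a fin_num.
    rewrite ge0_fin_numE//; apply: le_lt_trans hc _.
    by rewrite -(fineK (ball_fin hb bQ)) -EFinM ltry.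
  move=> /(_ isT); rewrite -ge0_muleDl ?lee_fin//; last by case/andP: gam01 => /ltW.
  move=> lt; have := le_lt_trans thick lt; rewrite ltNge -EFinD.
  by rewrite lee_wpmul2r// lee_fin.
exact: dev_shift xc xc0.
Qed.

(** On an enlarged stopping ball with centre [c], a point with
    |f - c0| > t + 2M has |f - c| > M because |c - c0| <= M + t, so the step by
    2M gains the factor [bet] on each of these balls. *)
Lemma decay_step (B0 : set X) (c0 t : R) : balls B0 ->
  mu (B0 `&` dev c0 t) <= bet%:E * mu B0 ->
  mu (B0 `&` dev c0 (t + 2 * M)) <= q%:E * mu (B0 `&` dev c0 t).
Proof.
move=> bB0 hF; have mB0 := bb_measurable hb bB0.
have /andP[gam0 gam1] := gam01.
set F := B0 `&` dev c0 t; set F' := B0 `&` dev c0 (t + 2 * M).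
have mF : measurable F by apply: measurableI => //; exact: measurable_dev.
have mF' : measurable F' by apply: measurableI => //; exact: measurable_dev.
have F'F : F' `<=` F.
  move=> x [Bx lt]; split => //; apply: le_lt_trans lt.
  by rewrite lee_fin lerDl mulr_ge0.
have B0gt0 : 0 < mu B0 by have /andP[] := bb_measure hb bB0.
have etaF : eta%:E * mu F <= gam%:E * mu B0.
  apply: (@le_trans _ _ (eta%:E * (bet%:E * mu B0))).
    by apply: lee_wpmul2l => //; rewrite lee_fin ltW.
  by rewrite muleA -EFinM; apply: lee_wpmul2r => //; rewrite lee_fin.
have KF : K%:E * mu F < gam%:E * mu B0.
  apply: (@le_lt_trans _ _ (K%:E * (bet%:E * mu B0))).
    by apply: lee_wpmul2l => //; rewrite lee_fin ltW.
  by rewrite muleA -EFinM lte_pmul2r ?(ball_fin hb)// lte_fin.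
apply/lee_addgt0Pr => eps eps0.
have [s [Q [ms ds hs cs]]] := stopping_cover hb K0 eta0 gam01 eps0 hK hd hreg
  bB0 mF (@subIsetl _ _ _) etaF KF.
have mQ A : A \in s -> measurable (Q A).
  by move=> /hs[bQ _ _ _ _]; exact: (bb_measurable hb).
pose U := \bigcup_(A in [set` s]) Q A.
have mU : measurable U by apply: fin_bigcup_measurable => //= A As; exact: mQ.
rewrite (measureDI mu mF' mU) addeC; apply: leeD; last first.
  apply: le_trans (ltW cs); apply: le_measure; rewrite ?inE.
  - exact: measurableD.
  - exact: measurableD.
  - by move=> x [/F'F].
apply: le_trans (measure_le_sum_cover (H := Q) (s := s) _ _ _ _) _ => //.
  exact: measurableI.
apply: (@le_trans _ _ (\sum_(A <- s) q%:E * mu (F `&` A))); last first.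
  rewrite -ge0_sume_distrr//; apply: lee_wpmul2l; last exact: sum_disjoint_le.
  rewrite lee_fin -(pmulr_lge0 _ gam0); apply: le_trans bet_q.
  by rewrite !mulr_ge0// ltW.
apply: lee_sum_seq => A As; have [bQ gA KQ sparse thick] := hs A As.
have mQA := mQ _ As.
have [c [hc cc0]] := center_near bQ bB0 sparse thick.
apply: (@le_trans _ _ (mu (Q A `&` dev c M))).
  apply: le_measure; rewrite ?inE.
  - by apply: measurableI => //; exact: measurableI.
  - by apply: measurableI => //; exact: measurable_dev.
  - move=> x [[[B0x lt] _] QAx]; split => //; rewrite /dev /= ltNge.
    apply/negP => le; have := dev_le le cc0; rewrite leNgt => /negP; apply.
    by rewrite (_ : (M + (M + t) = t + 2 * M)%R)//; ring.
apply: (le_trans hc); apply: (@le_trans _ _ (bet%:E * ((K * eta)%:E * mu A))).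
  by apply: lee_wpmul2l => //; rewrite lee_fin.
apply: (@le_trans _ _ (((q * gam)%:E * mu A))).
  by rewrite muleA -EFinM; apply: lee_wpmul2r => //; rewrite lee_fin.
rewrite EFinM -muleA; apply: lee_wpmul2l => //.
rewrite lee_fin -(pmulr_lge0 _ gam0); apply: le_trans bet_q.
by rewrite !mulr_ge0// ltW.
Qed.

Context (q01 : (0 <= q <= 1)%R) (bet1 : (bet <= 1)%R).

Lemma decay_iter (B0 : set X) (c0 : R) (k : nat) : balls B0 ->
  mu (B0 `&` dev c0 M) <= bet%:E * mu B0 ->
  mu (B0 `&` dev c0 ((2 * k%:R + 1) * M)) <= (bet * q ^+ k)%:E * mu B0.
Proof.
move=> bB0 h0; have /andP[q0 q1] := q01.
elim: k => [|k IHk]; first by rewrite mulr0 add0r mul1r expr0 mulr1.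
have -> : ((2 * k.+1%:R + 1) * M = (2 * k%:R + 1) * M + 2 * M)%R.
  by rewrite -addn1 natrD; ring.
apply: le_trans (decay_step bB0 _) _.
  apply: le_trans IHk _; apply: lee_wpmul2r => //; rewrite lee_fin.
  by rewrite ler_piMr// exprn_ile1.
rewrite exprS mulrCA EFinM -muleA; apply: lee_wpmul2l => //.
Qed.

End Decay.

(** * From oscillation to centres *)

Section NullSections.
Context {d : measure_display} {R : realType} {X : measurableType d}.
Context (mu : {measure set X -> \bar R}) (sf : sigma_finite [set: X] mu).

(* The copy nu of mu carries the sigma-finite structure, which measurability of
   the sections requires. *)
Let nu : set X -> \bar R := mu.
HB.instance Definition _ := Measure.on nu.
HB.instance Definition _ := Measure_isSigmaFinite.Build _ _ _ nu sf.

Lemma ae_null_xsection (N : set (X * X)) : measurable N ->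
  (mu \x mu) N = 0 -> {ae mu, forall x, mu (xsection N x) = 0}.
Proof.
move=> mN N0.
have mphi : measurable_fun [set: X] (mu \o xsection N).
  exact: (measurable_fun_xsection nu mN).
have := (ae_eq_integral_abs mu measurableT mphi).1.
rewrite (eq_integral (mu \o xsection N)); last by move=> x _; rewrite gee0_abs.
by move=> /(_ N0); apply: filterS => x /(_ I).
Qed.

End NullSections.

Section Centers.
Context {d : measure_display} {R : realType} {X : measurableType d}.
Context (mu : {measure set X -> \bar R}).

(** Approximating the whole space up to measure 1 covers it by countably many
    balls and one set of measure less than 1. *)
Lemma ball_basis_sigma_finite (balls : set (set X)) (hull : set X -> set X) :
  ball_basis mu balls hull -> sigma_finite [set: X] mu.
Proof.
move=> hb; have [J [Bk [bB lt]]] := bb_approx hb measurableT (@ltr01 R).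
pose U := \bigcup_(k in J) Bk k.
have mBk k : J k -> measurable (Bk k).
  by move=> Jk; apply: (bb_measurable hb); exact: bB.
have mU : measurable U by exact: bigcup_measurable.
pose F n := if n is k.+1 then (if pselect (J k) then Bk k else set0) else ~` U.
exists F.
  apply/seteqP; split=> // x _.
  have [[k Jk Bx]|nU] := pselect (U x); last by exists 0%N.
  by exists k.+1 => //; rewrite /F; case: pselect.
case=> [|k]; rewrite /F.
  split; first exact: measurableC.
  apply: le_lt_trans (ltry 1%R); apply: le_trans (ltW lt).
  apply: le_measure; rewrite ?inE; first exact: measurableC.
    by apply: measurableU; exact: measurableD.
  by move=> x nU; left.
case: pselect => Jk; last first.
  by rewrite /= measure0; split.
by split; [exact: mBk|have /andP[] := bb_measure hb (bB _ Jk)].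
Qed.

Lemma ae_exists_in (E : set X) (P : set X) : measurable E -> 0 < mu E ->
  {ae mu, forall x, P x} -> exists2 x, E x & P x.
Proof.
move=> mE E0 [N [mN N0 sub]]; apply: contrapT => nex.
suff : mu E <= mu N by rewrite N0 leNgt E0.
apply: le_measure; rewrite ?inE// => x Ex; apply: sub => Px.
by apply: nex; exists x.
Qed.

(** By Fubini, for almost every [x] in [E] almost every [y] in [E] satisfies
    |f x - f y| <= M; the value of [f] at one such [x] is the centre. *)
Lemma osc_center (E : set X) (f : X -> \bar R) (M : R) :
  sigma_finite [set: X] mu -> L0 mu f -> measurable E -> 0 < mu E ->
  OSC mu E f < M%:E -> exists c, mu (E `&` dev f c M) = 0.
Proof.
move=> sf [mf ff] mE E0 /ereal_inf_lt[M1 [N [mN N0 sub]] ltM].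
have [x Ex [Nx fx]] := ae_exists_in mE E0
  (filterI (ae_null_xsection sf mN N0) ff).
exists (fine (f x)).
apply: (@subset_measure0 _ _ _ mu _ (xsection N x)) => //.
- by apply: measurableI => //; exact: measurable_dev.
- exact: measurable_xsection.
move=> y [Ey lt]; rewrite /xsection /= inE; apply: sub => /= /(_ Ex Ey) le.
have {}lt : M%:E < `|f y - f x| by move: lt; rewrite -{2}(fineK fx).
move: lt; rewrite ltNge => /negP; apply.
apply: le_trans (ltW ltM); apply: le_trans le.
by rewrite -(fineK fx); case: (f y) => [z| |] //=; rewrite lee_fin distrC.
Qed.

Lemma BMOa_center (balls : set (set X)) (hull : set X -> set X) (alpha M : R)
    (f : X -> \bar R) (B : set X) : ball_basis mu balls hull -> (0 <= alpha)%R ->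
  L0 mu f -> BMOa_norm mu balls alpha f < M%:E -> balls B ->
  exists c, mu (B `&` dev f c M) <= (1 - alpha)%:E * mu B.
Proof.
move=> hb a0 fL ltM bB; have mB := bb_measurable hb bB.
have : OSC_ball mu B alpha f < M%:E.
  by apply: le_lt_trans ltM; apply: ereal_sup_ubound; exists B.
move=> /ereal_inf_lt[_ [E [mE EB ltE] <-] ltOSC].
have E0 : 0 < mu E by apply: le_lt_trans ltE; rewrite mule_ge0.
have [c hc] := osc_center (ball_basis_sigma_finite hb) fL mE E0 ltOSC.
exists c; have mD : measurable (dev f c M) by apply: measurable_dev; case: fL.
have eB : mu B = mu (B `\` E) + mu E.
  by rewrite -{2}(setIidr EB); exact: measureDI.
have : mu (B `&` dev f c M) <= mu (B `\` E).
  rewrite -[leRHS]add0e -hc addeC.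
  apply: le_trans (measureU2 _ _ _).
  - apply: le_measure; rewrite ?inE; first exact: measurableI.
      by apply: measurableU; [exact: measurableD|exact: measurableI].
    move=> x [Bx dx]; have [Ex|nEx] := pselect (E x); first by right.
    by left.
  - exact: measurableD.
  - exact: measurableI.
move=> /le_trans; apply; move: eB ltE.
have fB := ball_fin hb bB.
have fE : mu E \is a fin_num.
  rewrite ge0_fin_numE// (@le_lt_trans _ _ (mu B))//.
    by apply: le_measure; rewrite ?inE.
  by rewrite -ge0_fin_numE.
have fD : mu (B `\` E) \is a fin_num.
  rewrite ge0_fin_numE// (@le_lt_trans _ _ (mu B))//.
    by apply: le_measure; rewrite ?inE//; exact: measurableD.
  by rewrite -ge0_fin_numE.
rewrite -(fineK fB) -(fineK fE) -(fineK fD) -!EFinM -EFinD lte_fin lee_fin.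
move=> [eB] ltE; lra.
Qed.

End Centers.

Lemma poweR_addr_le (R : realType) (x b : \bar R) (r : R) :
  0 <= x -> 0 <= b -> (0 <= r)%R ->
  (x + b) `^ r <= (2 `^ r)%:E * (x `^ r + b `^ r).
Proof.
move=> x0 b0 r0.
have mon (y z : \bar R) : 0 <= y -> y <= z -> y `^ r <= z `^ r.
  move=> y0 yz; apply: gt0_ler_poweR => //; rewrite in_itv /= ?y0 ?(le_trans y0 yz) ?leey//.
wlog bx : x b x0 b0 / b <= x.
  move=> H; have /orP[xb|bx] := le_total x b; last exact: H.
  by rewrite addeC [X in _ * X]addeC; exact: H.
apply: (@le_trans _ _ ((2%:E * x) `^ r)).
  apply: mon; first exact: adde_ge0.
  by rewrite (_ : 2%:E = 1 + 1 :> \bar R)// ge0_muleDl// mul1e leeD2l.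
rewrite poweRM// poweR_EFin; apply: lee_wpmul2l; first by rewrite lee_fin powR_ge0.
by rewrite leeDl// poweR_ge0.
Qed.

(** * Comparison of the two oscillations on a ball *)

Section MeanOscillation.
Context {d : measure_display} {R : realType} {X : measurableType d}.
Context (mu : {measure set X -> \bar R}).

Lemma integral_recenter (B : set X) (f : X -> \bar R) (c a b r : R) :
  measurable B -> measurable_fun [set: X] f -> (0 <= r)%R ->
  (`|c - a| <= b)%R ->
  \int[mu]_(x in B) (`|f x - a%:E| `^ r) <=
  (2 `^ r)%:E * (\int[mu]_(x in B) (`|f x - c%:E| `^ r) + (b `^ r)%:E * mu B).
Proof.
move=> mB mf r0 cab.
have b0 : (0 <= b)%R by exact: le_trans cab.
have mdev e : measurable_fun B (fun x => `|f x - e%:E| `^ r).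
  apply: (measurableT_comp (measurable_poweR r)).
  by apply: measurable_funTS; exact: measurable_dev_fun.
have pow0 e x : 0 <= `|f x - e%:E| `^ r by exact: poweR_ge0.
rewrite -integral_cst// -ge0_integralD//; last first.
  by move=> x _; rewrite lee_fin powR_ge0.
rewrite -ge0_integralZl_EFin ?powR_ge0//; last 2 first.
- by move=> x _; rewrite adde_ge0// lee_fin powR_ge0.
- by apply: emeasurable_funD.
apply: ge0_le_integral => //.
- apply: measurable_funeM; exact: emeasurable_funD.
move=> x _.
apply: (@le_trans _ _ ((`|f x - c%:E| + b%:E) `^ r)); last first.
  by apply: le_trans (poweR_addr_le _ _ _) _.
apply: gt0_ler_poweR => //; rewrite ?in_itv /= ?leey ?abse_ge0 ?adde_ge0//.
case: (f x) => [v| |] //=; rewrite lee_fin.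
have -> : (v - a = (v - c) + (c - a))%R by ring.
by rewrite (le_trans (ler_normD _ _))// lerD.
Qed.

Lemma mean_dist (B : set X) (f : X -> \bar R) (c D : R) :
  measurable B -> 0 < mu B < +oo -> measurable_fun [set: X] f ->
  \int[mu]_(x in B) `|f x - c%:E| <= D%:E * mu B ->
  exists m, mean mu B f = m%:E /\ (`|c - m| <= D)%R.
Proof.
move=> mB /andP[B0 Boo] mf hD.
have fB : mu B \is a fin_num by rewrite ge0_fin_numE.
have mB0 : (0 < fine (mu B))%R by rewrite fine_gt0 ?B0.
pose g x := f x - c%:E.
have mg : measurable_fun B g.
  by apply: measurable_funTS; apply: emeasurable_funB => //; exact: measurable_cst.
have ig : mu.-integrable B g.
  apply/integrableP; split => //; apply: le_lt_trans hD _.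
  by rewrite -(fineK fB) -EFinM ltry.
have fg := integrable_fin_num mB ig.
have ic : mu.-integrable B (cst c%:E).
  apply/integrableP; split => //.
  by rewrite integral_cst// -(fineK fB) -EFinM ltry.
have eqf : \int[mu]_(x in B) f x = \int[mu]_(x in B) g x + c%:E * mu B.
  rewrite -[X in _ = _ + X]integral_cst// -integralD//.
  by apply: eq_integral => x _; rewrite /g subeK.
exists (fine (\int[mu]_(x in B) g x) / fine (mu B) + c)%R; split.
  rewrite /mean eqf -(fineK fg) -[in c%:E * _](fineK fB) -EFinM /=.
  by congr EFin; field; rewrite gt_eqF.
rewrite opprD addrCA subrr addr0 normrN normrM normfV [X in (_ / X)%R]gtr0_norm//.
rewrite ler_pdivrMr// -lee_fin EFinM fineK//; apply: le_trans hD.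
have -> : (`|fine (\int[mu]_(x in B) g x)|)%:E = `|\int[mu]_(x in B) g x|.
  by rewrite -{2}(fineK fg).
exact: le_abse_integral.
Qed.

End MeanOscillation.

Section Comparison.
Context {d : measure_display} {R : realType} {X : measurableType d}.
Context (mu : {measure set X -> \bar R}).

Lemma mean_le (B : set X) (g : X -> \bar R) (c : R) : 0 < mu B < +oo ->
  (mean mu B g <= c%:E) = (\int[mu]_(x in B) g x <= c%:E * mu B).
Proof.
move=> /andP[B0 Boo]; have fB : mu B \is a fin_num by rewrite ge0_fin_numE.
rewrite /mean lee_pdivrMl; last by rewrite fine_gt0// B0.
by rewrite fineK// muleC.
Qed.

Lemma poweR_root_le (x : \bar R) (a r : R) : 0 <= x -> (0 <= a)%R -> (0 < r)%R ->
  (x `^ r^-1 <= a%:E) = (x <= (a `^ r)%:E).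
Proof.
move=> x0 a0 r0; apply/idP/idP => h.
- have := @gt0_ler_poweR R r (ltW r0) (x `^ r^-1) a%:E.
  rewrite -poweRrM mulVf ?gt_eqF// poweRe1// poweR_EFin; apply => //.
  + by rewrite in_itv /= poweR_ge0 leey.
  + by rewrite in_itv /= lee_fin a0 leey.
- have := @gt0_ler_poweR R r^-1 _ x (a `^ r)%:E.
  rewrite poweR_EFin -powRrM mulfV ?gt_eqF// powRr1//; apply => //.
  + by rewrite invr_ge0 ltW.
  + by rewrite in_itv /= x0 leey.
  + by rewrite in_itv /= lee_fin powR_ge0 leey.
Qed.

(** The constant of [integral_powR_layers] for the exponent [r]. *)
Definition moment_const (r : R) : R := (1 + 2 * 3 `^ r)%R.

(** The moments of order 1 bound the distance from the centre to the mean by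
    [moment_const 1 * M], and |x + b|^r <= 2^r (|x|^r + |b|^r). *)
Definition bmo_const (r : R) : R :=
  ((2 `^ r * (moment_const r + (moment_const 1) `^ r)) `^ r^-1)%R.

Lemma moment_const_gt0 (r : R) : (0 < moment_const r)%R.
Proof. by rewrite /moment_const ltr_wpDr// mulr_ge0 ?powR_ge0. Qed.

Lemma bmo_const_gt0 (r : R) : (0 < bmo_const r)%R.
Proof.
by rewrite powR_gt0// mulr_gt0 ?powR_gt0// ltr_wpDr ?powR_ge0// moment_const_gt0.
Qed.

Lemma oscillation_of_moments (B : set X) (f : X -> \bar R) (c M r : R) :
  measurable B -> 0 < mu B < +oo -> measurable_fun [set: X] f ->
  (0 < M)%R -> (0 < r)%R ->
  \int[mu]_(x in B) `|f x - c%:E| <= (moment_const 1 * M)%:E * mu B ->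
  \int[mu]_(x in B) (`|f x - c%:E| `^ r) <= (moment_const r * M `^ r)%:E * mu B ->
  mu.-integrable B (fun x => `|f x| `^ r) /\
  (mean mu B (fun x => `|f x - mean mu B f| `^ r)) `^ (r^-1)%R <=
    (bmo_const r * M)%:E.
Proof.
move=> mB muB mf M0 r0 h1 hr; have /andP[B0 Boo] := muB.
have fB : mu B \is a fin_num by rewrite ge0_fin_numE.
have k1 := moment_const_gt0 1; have kr := moment_const_gt0 r.
split.
  apply/integrableP; split.
    apply: (measurableT_comp (measurable_poweR r)).
    by apply: measurableT_comp => //; exact: measurable_funTS.
  apply: (@le_lt_trans _ _ (\int[mu]_(x in B) (`|f x - 0%:E| `^ r))).
    rewrite le_eqVlt; apply/orP; left; apply/eqP; apply: eq_integral => x _.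
    by rewrite sube0 gee0_abs// poweR_ge0.
  have c00 : (`|c - 0| <= `|c - 0|)%R by [].
  apply: le_lt_trans (integral_recenter mu mB mf (ltW r0) c00) _.
  apply: (@le_lt_trans _ _ ((2 `^ r)%:E *
      ((moment_const r * M `^ r)%:E * mu B + (`|c - 0| `^ r)%:E * mu B))).
    by apply: lee_wpmul2l; [rewrite lee_fin powR_ge0|exact: leeD2r].
  by rewrite -(fineK fB) -!EFinM ltry.
have [m [-> cm]] := mean_dist mB muB mf h1.
rewrite poweR_root_le//; last 2 first.
- by rewrite /mean mule_ge0// integral_ge0// => x _; exact: poweR_ge0.
- by rewrite mulr_ge0 ?(ltW M0)// ltW// bmo_const_gt0.
rewrite mean_le//; apply: le_trans (integral_recenter mu mB mf (ltW r0) cm) _.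
apply: (@le_trans _ _ ((2 `^ r)%:E * ((moment_const r * M `^ r)%:E * mu B +
   ((moment_const 1 * M) `^ r)%:E * mu B))).
  by apply: lee_wpmul2l; [rewrite lee_fin powR_ge0|exact: leeD2r].
rewrite -(fineK fB) -!EFinM lee_fin !powRM ?(ltW k1) ?(ltW M0) ?powR_ge0//.
rewrite /bmo_const -powRrM mulVf ?gt_eqF// powRr1; last first.
  by rewrite mulr_ge0 ?powR_ge0// addr_ge0 ?powR_ge0 ?ltW.
by rewrite le_eqVlt; apply/orP; left; apply/eqP; ring.
Qed.

(** Here the inequality holds for all pairs of points, so the exceptional set of
    pairs is empty. *)
Lemma OSC_le_of_dev (E : set X) (f : X -> \bar R) (m t : R) :
  (forall x, E x -> `|f x - m%:E| <= t%:E) -> OSC mu E f <= (2 * t)%:E.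
Proof.
move=> hE; apply: ereal_inf_lbound => /=; exists set0; split => //.
  by rewrite /product_measure1 integral0_eq// => x _ /=; rewrite xsection0 measure0.
move=> [x y] /= h; apply: h => Ex Ey; have := hE _ Ey; have := hE _ Ex.
case: (f x) => [v| |] //; case: (f y) => [w| |] //=; rewrite !lee_fin => vm wm.
have -> : (v - w = (v - m) - (w - m))%R by ring.
by rewrite (le_trans (ler_normB _ _))//; lra.
Qed.

(** Chebyshev's inequality at the height t = (n + e') / (1 - alpha), for a small
    e' > 0. As 1 <= r, the factor (1 - alpha)^(-r) is at least 1 / (1 - alpha), so
    the set where |f - m| > t has measure less than (1 - alpha) mu(B). *)
Lemma OSC_ball_le (B : set X) (f : X -> \bar R) (alpha m n r : R) :
  measurable B -> 0 < mu B < +oo -> measurable_fun [set: X] f ->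
  (0 <= alpha < 1)%R -> (0 <= n)%R -> (1 <= r)%R ->
  \int[mu]_(x in B) (`|f x - m%:E| `^ r) <= (n `^ r)%:E * mu B ->
  OSC_ball mu B alpha f <= (2 / (1 - alpha) * n)%:E.
Proof.
move=> mB /andP[B0 Boo] mf /andP[a0 a1] n0 r1 hint.
have fB : mu B \is a fin_num by rewrite ge0_fin_numE.
have r0 : (0 < r)%R by exact: lt_le_trans r1.
have bet0 : (0 < 1 - alpha)%R by rewrite subr_gt0.
apply/lee_addgt0Pr => e e0.
(* The summand with e makes the bound strict also when n = 0. *)
pose t : R := ((1 - alpha)^-1 * (n + (1 - alpha) / 2 * e))%R.
have ne : (n < n + (1 - alpha) / 2 * e)%R by rewrite ltrDl mulr_gt0// divr_gt0.
have t0 : (0 < t)%R by rewrite mulr_gt0 ?invr_gt0// (le_lt_trans n0).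
have tr : (n `^ r < (1 - alpha) * t `^ r)%R.
  rewrite mulrC -ltr_pdivrMr// mulrC.
  apply: (@lt_le_trans _ _ ((1 - alpha)^-1 * (n + (1 - alpha) / 2 * e) `^ r)%R).
    rewrite ltr_pM2l ?invr_gt0//; apply: gt0_ltr_powR => //.
    by rewrite nnegrE (le_trans n0)// ltW.
  apply: le1r_powRZ => //; last by rewrite (le_trans n0)// ltW.
  by rewrite invf_ge1//; lra.
have -> : ((2 / (1 - alpha) * n)%:E + e%:E = (2 * t)%:E).
  by rewrite -EFinD; congr EFin; rewrite /t; field; rewrite gt_eqF.
pose E := B `\` dev f m t.
have mD : measurable (dev f m t) by exact: measurable_dev.
have mE : measurable E by exact: measurableD.
apply: (@le_trans _ _ (OSC mu E f)); last first.
  by apply: (OSC_le_of_dev (m := m)) => x [_]; rewrite /dev /= => /negP; rewrite -leNgt.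
apply: ereal_inf_lbound; exists E => //; split => //; first exact: subDsetl.
have cheb : (t `^ r)%:E * mu (B `&` dev f m t) <= (n `^ r)%:E * mu B.
  have trpos : (0 < t `^ r)%R by rewrite powR_gt0.
  have mg : measurable_fun B (fun x => `|f x - m%:E| `^ r).
    apply: (measurableT_comp (measurable_poweR r)).
    by apply: measurable_funTS; exact: measurable_dev_fun.
  apply: le_trans hint; apply: le_trans (le_trans _ (le_integral_abse mu mB mg trpos)) _.
  - apply: lee_wpmul2l; first by rewrite lee_fin ltW.
    apply: le_measure; rewrite ?inE; first exact: measurableI.
      by apply: emeasurable_fun_c_infty => //; exact: measurableT_comp.
    move=> x [Bx lt]; split => //=; rewrite gee0_abs ?poweR_ge0// -poweR_EFin.
    apply: gt0_ler_poweR; rewrite ?in_itv /= ?leey ?lee_fin ?abse_ge0 ?(ltW t0) ?(ltW r0)//.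
    exact: ltW lt.
  - rewrite le_eqVlt; apply/orP; left; apply/eqP; apply: eq_integral => x _.
    by rewrite gee0_abs// poweR_ge0.
have eB : mu B = mu E + mu (B `&` dev f m t) by exact: measureDI.
have /andP[fE fI] : (mu E \is a fin_num) && (mu (B `&` dev f m t) \is a fin_num).
  by rewrite -fin_numD -eB.
move: cheb eB B0; rewrite -(fineK fB) -(fineK fE) -(fineK fI) -!EFinM -EFinD !lte_fin.
rewrite lee_fin => cheb [eB] b0.
have trpos : (0 < t `^ r)%R by rewrite powR_gt0.
have : (t `^ r * fine (mu (B `&` dev f m t)) < (1 - alpha) * t `^ r * fine (mu B))%R.
  by apply: le_lt_trans cheb _; rewrite ltr_pM2r.
rewrite mulrAC [X in (_ < X)%R]mulrC ltr_pM2l//; lra.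
Qed.

End Comparison.

(** * Comparison of the norms *)

Section SelfImprovement.
Context {d : measure_display} {R : realType} {X : measurableType d}.
Context (mu : {measure set X -> \bar R}) (balls : set (set X))
  (hull : set X -> set X) (hb : ball_basis mu balls hull).

Lemma moment_of_decay (B : set X) (f : X -> \bar R) (c M q r p : R) :
  balls B -> L0 mu f -> (0 < M)%R -> (0 <= q)%R -> (0 <= p <= r)%R ->
  (2 `^ r * q <= 2^-1)%R ->
  (forall k : nat, mu (B `&` dev f c ((2 * k%:R + 1) * M)) <= (q ^+ k)%:E * mu B) ->
  \int[mu]_(x in B) (`|f x - c%:E| `^ p) <= (moment_const p * M `^ p)%:E * mu B.
Proof.
move=> bB [mf ff] M0 q0 /andP[p0 pr] hq decay.
apply: (integral_powR_layers _ _ _ _ _ M0 p0 q0) decay.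
- exact: (bb_measurable hb).
- exact: (ball_fin hb bB).
- by apply: measurable_funTS; exact: measurable_dev_fun.
- by move=> x; exact: abse_ge0.
- by apply: filterS ff => x fx; rewrite abse_fin_num fin_numB fx.
- by apply: le_trans hq; apply: ler_wpM2r => //; apply: ler_powR => //; lra.
Qed.

(** The constants: gam = theta / 2 leaves room for bet in gam + bet <= theta;
    q = 2^(-r) / 2 makes the moments of order up to [r] converge; and
    bet = gam q / (2 K eta) meets the requirements of [decay_step]. *)
Lemma BMOa_self_improvement (r : R) : doubling mu balls hull ->
  regular mu balls hull -> (1 <= r)%R ->
  exists2 alpha : R, (2^-1 < alpha < 1)%R &
    forall (f : X -> \bar R) (M : R) (B : set X), L0 mu f -> (0 < M)%R ->
      BMOa_norm mu balls alpha f < M%:E -> balls B ->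
      mu.-integrable B (fun x => `|f x| `^ r) /\
      (mean mu B (fun x => `|f x - mean mu B f| `^ r)) `^ (r^-1)%R <=
        (bmo_const r * M)%:E.
Proof.
move=> [eta eta2 hd] [theta /andP[th0 th1] hreg] r1.
have [K0 K00 hK0] := bb_hull_measure hb.
(* Enlarging the hull constant to be above 1 makes bet small against gam. *)
pose K := (K0 + 1)%R.
have K1 : (1 < K)%R by rewrite /K; lra.
have hK B : balls B -> mu (hull B) <= K%:E * mu B.
  move=> bB; apply: le_trans (hK0 _ bB) _; apply: lee_wpmul2r => //.
  by rewrite lee_fin /K; lra.
have r0 : (0 < r)%R by exact: lt_le_trans r1.
pose q := ((2 `^ r)^-1 / 2)%R.
have p2 : (2 <= 2 `^ r :> R)%R by apply: le1r_powR => //; lra.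
have p20 : (0 < 2 `^ r :> R)%R by exact: powR_gt0.
have q0 : (0 < q)%R by rewrite divr_gt0// invr_gt0.
have hq : (2 `^ r * q <= 2^-1)%R by rewrite /q mulrA mulfV ?gt_eqF// mul1r.
have q1 : (q <= 1)%R.
  apply: le_trans (_ : 2 `^ r * q <= _)%R; last by lra.
  by rewrite ler_peMl ?(ltW q0)//; lra.
pose gam := (theta / 2)%R.
have gam0 : (0 < gam)%R by rewrite /gam; lra.
pose bet := (gam * q / (2 * K * eta))%R.
have K_0 : (0 < K)%R by lra.
have eta0 : (0 < eta)%R by lra.
have den0 : (0 < 2 * K * eta)%R by rewrite !mulr_gt0.
have bet0 : (0 < bet)%R by rewrite divr_gt0// mulr_gt0.
have betE : (bet * (K * eta) = gam * q / 2)%R.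
  by rewrite /bet; field; rewrite !gt_eqF.
have gq : (gam * q <= gam)%R by rewrite ler_piMr// ltW.
have gq0 : (0 < gam * q)%R by rewrite mulr_gt0.
have Keta : (eta <= K * eta)%R by rewrite ler_peMl ?ltW.
have Keta' : (K <= K * eta)%R by rewrite ler_peMr ?ltW//; lra.
have Keta1 : (1 <= K * eta)%R by lra.
have bet_eta : (eta * bet <= gam * q / 2)%R by rewrite -betE mulrC ler_pM2l.
have bet_K : (K * bet <= gam * q / 2)%R by rewrite -betE mulrC ler_pM2l.
have bet_1 : (bet <= gam * q / 2)%R by rewrite -betE ler_peMr// ltW.
exists (1 - bet)%R; first by rewrite /gam in bet_1 gq *; apply/andP; split; lra.
move=> f M B fL M0 ltM bB; have [mf ff] := fL.
have hosc Q : balls Q -> exists c, mu (Q `&` dev f c M) <= bet%:E * mu Q.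
  move=> bQ; have := @BMOa_center _ _ _ mu balls hull (1 - bet) M f Q hb _ fL ltM bQ.
  by rewrite subKr; apply; rewrite /gam in bet_1 gq *; lra.
have [c hc] := hosc _ bB.
have decay k : mu (B `&` dev f c ((2 * k%:R + 1) * M)) <= (q ^+ k)%:E * mu B.
  have gam01 : (0 < gam < 1)%R by rewrite gam0 /gam; lra.
  have q01 : (0 <= q <= 1)%R by rewrite q1 ltW.
  have bq : (bet * (K * eta) <= q * gam)%R by rewrite betE mulrC; lra.
  have gb : (gam + bet <= theta)%R by rewrite /gam in bet_1 gq *; lra.
  have be : (eta * bet <= gam)%R by lra.
  have bK : (K * bet < gam)%R by lra.
  have b1 : (bet <= 1)%R by rewrite /gam in bet_1 gq *; lra.
  apply: le_trans (decay_iter hb mf K_0 eta0 gam01 (ltW bet0) (ltW M0) hK hd hreg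
    gb be bK bq hosc q01 k bB hc) _.
  by apply: lee_wpmul2r => //; rewrite lee_fin ler_piMl ?exprn_ge0 ?(ltW q0).
apply: (@oscillation_of_moments _ _ _ mu B f c) => //.
- exact: (bb_measurable hb).
- exact: (bb_measure hb).
- have := @moment_of_decay B f c M q r 1 bB fL M0 (ltW q0) _ hq decay.
  rewrite powRr1 ?(ltW M0)// => /(_ _)/le_trans h; apply: le_trans (h _ _ _); last 2 first.
  + by rewrite ler01.
  + by [].
  rewrite le_eqVlt; apply/orP; left; apply/eqP; apply: eq_integral => x _.
  by rewrite poweRe1.
- by apply: (moment_of_decay bB fL M0 (ltW q0) _ hq decay); rewrite ltW/=.
Qed.

(** If the norm were negative, some [M < 0] would be admissible, and then
    |f - c| > M on the whole ball, which has more than the allowed measure. *)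
Lemma BMOa_norm_ge0 (alpha : R) (f : X -> \bar R) : (0 < alpha)%R ->
  L0 mu f -> balls !=set0 -> 0 <= BMOa_norm mu balls alpha f.
Proof.
move=> a0 fL [B bB]; rewrite leNgt; apply/negP => lt0.
have [M M0 ltM] : exists2 M : R, (M < 0)%R & BMOa_norm mu balls alpha f < M%:E.
  move: lt0; case: (BMOa_norm _ _ _ _) => [v| |] // v0; last first.
    by exists (-1)%R; rewrite ?ltrN10// ltNyr.
  by exists (v / 2)%R; rewrite ?lte_fin; rewrite lte_fin in v0; lra.
have [c] := BMOa_center hb (ltW a0) fL ltM bB.
have -> : B `&` dev f c M = B.
  by apply/setIidPl => x _; rewrite /dev /=; apply: lt_le_trans (abse_ge0 _).
have /andP[B0 _] := bb_measure hb bB; rewrite -(fineK (ball_fin hb bB)).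
have b0 : (0 < fine (mu B))%R by rewrite fine_gt0// (bb_measure hb).
rewrite -EFinM lee_fin mulrBl mul1r; have := mulr_gt0 a0 b0; lra.
Qed.

Lemma BMOa_norm_le_BMO_norm (alpha r : R) (f : X -> \bar R) :
  (0 <= alpha < 1)%R -> (1 <= r)%R -> BMO mu balls r f ->
  BMOa_norm mu balls alpha f <= (2 / (1 - alpha))%:E * BMO_norm mu balls r f.
Proof.
move=> a01 r1 [[mf ff] intf norm_oo].
have r0 : (0 < r)%R by exact: lt_le_trans r1.
apply: ge_ereal_sup => _ [B bB <-].
have mB := bb_measurable hb bB; have muB := bb_measure hb bB.
have leB : (mean mu B (fun x => `|f x - mean mu B f| `^ r)) `^ (r^-1)%R
    <= BMO_norm mu balls r f by apply: ereal_sup_ubound; exists B.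
have norm0 : 0 <= BMO_norm mu balls r f by apply: le_trans leB; exact: poweR_ge0.
have fin_norm : BMO_norm mu balls r f \is a fin_num by rewrite ge0_fin_numE.
move: leB norm0; rewrite -(fineK fin_norm); set n := fine _ => leB; rewrite lee_fin => n0.
(* Chebyshev needs a finite mean; it is finite because |f| <= 1 + |f|^r. *)
have [m [mE _]] : exists m, mean mu B f = m%:E /\
    (`|0 - m| <= 1 + fine (\int[mu]_(x in B) (`|f x| `^ r)) / fine (mu B))%R.
  apply: mean_dist => //.
  have fI := integrable_fin_num mB (intf _ bB).
  have fB := ball_fin hb bB.
  have b0 : (0 < fine (mu B))%R by rewrite fine_gt0.
  have -> : (1 + fine (\int[mu]_(x in B) (`|f x| `^ r)) / fine (mu B))%:E * mu B =
      \int[mu]_(x in B) (1 + `|f x| `^ r).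
    rewrite ge0_integralD//; last 2 first.
    - by move=> x _; exact: poweR_ge0.
    - apply: (measurableT_comp (measurable_poweR r)).
      by apply: measurableT_comp => //; exact: measurable_funTS.
    rewrite integral_cst// mul1e -(fineK fI) -(fineK fB) -EFinM -EFinD /=.
    by congr EFin; field; rewrite gt_eqF.
  apply: ge0_le_integral => //.
  - by apply: measurable_funTS; exact: measurable_dev_fun.
  - apply: emeasurable_funD => //; apply: (measurableT_comp (measurable_poweR r)).
    by apply: measurableT_comp => //; exact: measurable_funTS.
  - move=> x _; rewrite sube0; have := abse_ge0 (f x).
    case: `|f x| => [v| |] //; last by rewrite poweRyr ?gt_eqF.
    rewrite !lee_fin => v0; have [v1|v1] := leP v 1%R.
      by rewrite (le_trans v1)// lerDl powR_ge0.
    by rewrite (le_trans (le1r_powR (ltW v1) r1))// lerDr.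
rewrite -EFinM; apply: (OSC_ball_le mB muB mf a01 n0 r1 (m := m)).
rewrite -mean_le// -poweR_root_le//.
  by rewrite -mE.
by rewrite /mean mule_ge0// integral_ge0// => x _; exact: poweR_ge0.
Qed.

End SelfImprovement.

Theorem theorem1p3 (d : measure_display) (R : realType) (X : measurableType d)
    (mu : {measure set X -> \bar R})
    (balls : set (set X)) (hull : set X -> set X)
    (hbasis : ball_basis mu balls hull)
    (hdoubling : doubling mu balls hull)
    (hregular : regular mu balls hull)
    (r : R) (hr : (1 <= r)%R) :
  exists alpha : R, (2^-1 < alpha < 1)%R /\
    BMOa mu balls alpha = BMO mu balls r /\
    exists c C : R, [/\ (0 < c)%R, (0 < C)%R &
      forall f : X -> \bar R, BMOa mu balls alpha f ->
        c%:E * BMOa_norm mu balls alpha f <= BMO_norm mu balls r f /\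
        BMO_norm mu balls r f <= C%:E * BMOa_norm mu balls alpha f].
Proof.
have [alpha /andP[a2 a1] improve] :=
  BMOa_self_improvement hbasis hdoubling hregular hr.
have a0 : (0 < alpha)%R by lra.
have a01 : (0 <= alpha < 1)%R by rewrite ltW.
have D0 : (0 < 2 / (1 - alpha))%R by rewrite divr_gt0// subr_gt0.
have C0 := bmo_const_gt0 r.
have upper f : BMOa mu balls alpha f ->
    BMO_norm mu balls r f <= (bmo_const r)%:E * BMOa_norm mu balls alpha f.
  move=> [fL foo]; apply: ge_ereal_sup => _ [B bB <-].
  have n0 : 0 <= BMOa_norm mu balls alpha f.
    by apply: (BMOa_norm_ge0 hbasis) => //; exists B.
  have fin_norm : BMOa_norm mu balls alpha f \is a fin_num by rewrite ge0_fin_numE.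
  move: n0; rewrite -(fineK fin_norm) lee_fin; set n := fine _ => n0.
  apply/lee_addgt0Pr => e e0; rewrite -EFinM -EFinD.
  (* The self-improvement requires M above the norm; let M decrease to it. *)
  have -> : (bmo_const r * n + e = bmo_const r * (n + e / bmo_const r))%R.
    by field; rewrite gt_eqF.
  have eC : (0 < e / bmo_const r)%R by rewrite divr_gt0.
  have [] // := improve f (n + e / bmo_const r)%R B fL _ _ bB.
    by rewrite ltr_wpDl.
  by rewrite -(fineK fin_norm) lte_fin ltrDl.
have sub f : BMOa mu balls alpha f -> BMO mu balls r f.
  move=> fa; have [fL foo] := fa; split => //.
    move=> B bB.
    have n0 : 0 <= BMOa_norm mu balls alpha f.
      by apply: (BMOa_norm_ge0 hbasis) => //; exists B.
    have fin_norm : BMOa_norm mu balls alpha f \is a fin_num by rewrite ge0_fin_numE.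
    have M0 : (0 < fine (BMOa_norm mu balls alpha f) + 1)%R by rewrite ltr_wpDl ?fine_ge0.
    have [] // := improve f _ B fL M0 _ bB.
    by rewrite -{1}(fineK fin_norm) lte_fin ltrDl.
  apply: le_lt_trans (upper f fa) _; move: foo.
  by case: (BMOa_norm _ _ _ _) => [v| |] // _; rewrite ?gt0_muleNy ?lte_fin ?ltNyr ?ltry.
exists alpha; split; first by rewrite a2.
split.
  apply/seteqP; split => f; first exact: sub.
  move=> fB; have [fL _ foo] := fB; split => //.
  apply: le_lt_trans (BMOa_norm_le_BMO_norm hbasis a01 hr fB) _; move: foo.
  by case: (BMO_norm _ _ _ _) => [v| |] // _; rewrite ?gt0_muleNy ?lte_fin ?ltNyr ?ltry.
exists (2 / (1 - alpha))^-1%R, (bmo_const r); split => //; first by rewrite invr_gt0.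
move=> f fa; split; last exact: upper.
by rewrite lee_pdivrMl//; apply: (BMOa_norm_le_BMO_norm hbasis) => //; exact: sub.
Qed.
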